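(* Let $n\in\mathbb{N}$, let $G$ be an $n$-torus, and let $T$ be an automorphism of $G$. Then $T$ acts distally on $\mathrm{Sub}^p_G$ if and only if $T^m=\mathrm{Id}$, the identity map, for some $m\in\mathbb{N}$.
   Context: $\mathbb{N}=\{1,2,\dots\}$. An $n$-torus is a compact connected abelian Lie group of dimension $n$, i.e. isomorphic to $\mathbb{T}^n=\mathbb{R}^n/\mathbb{Z}^n$. Automorphisms of topological groups are group automorphisms that are also homeomorphisms. For a locally compact Hausdorff group $G$, $\mathrm{Sub}_G$ denotes the set of all closed subgroups of $G$ with the Chabauty topology, generated by the sub-basis consisting of the sets $\{H\in\mathrm{Sub}_G\mid H\cap K=\emptyset\}$, $K\subset G$ compact, and $\{H\in\mathrm{Sub}_G\mid H\cap U\neq\emptyset\}$, $U\subset G$ open. This space is compact and Hausdorff. A one-parameter subgroup of $G$ is (the image of) a continuous homomorphism $\mathbb{R}\to G$ (the trivial one is allowed). $\mathrm{Sub}^p_G$ denotes the smallest closed subset of $\mathrm{Sub}_G$ containing all closed one-parameter subgroups of $G$. An automorphism $T$ of $G$ acts on $\mathrm{Sub}_G$ by the homeomorphism $H\mapsto T(H)$, which leaves $\mathrm{Sub}^p_G$ invariant. A homeomorphism $\phi$ of a Hausdorff space $X$ is distal (acts distally on $X$) if for all $x\neq y$ in $X$, the closure of $\{(\phi^n(x),\phi^n(y))\mid n\in\mathbb{Z}\}$ in $X\times X$ does not intersect the diagonal $\{(d,d)\mid d\in X\}$. $T$ acts distally on an invariant subspace of $\mathrm{Sub}_G$ if the induced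 homeomorphism $H\mapsto T(H)$ of that subspace is distal. *)

(* Defs.v *)
From HB Require Import structures.
From mathcomp Require Import all_boot all_order all_algebra.
From mathcomp Require Import all_classical all_reals all_analysis.
Import numFieldNormedType.Exports.
Import Order.TTheory GRing.Theory Num.Theory.

Set Implicit Arguments.
Unset Strict Implicit.
Unset Printing Implicit Defensive.

Local Open Scope classical_set_scope.
Local Open Scope ring_scope.
Local Open Scope quotient_scope.

Record homeo (X Y : topologicalType) := Homeo {
  homeo_fun :> X -> Y;
  homeo_inv : Y -> X;
  homeoK : cancel homeo_fun homeo_inv;
  homeoVK : cancel homeo_inv homeo_fun;
  homeo_continuous : continuous homeo_fun;
  homeoV_continuous : continuous homeo_inv }.

(* [Negz m] is the integer -(m + 1). *)
Definition homeo_zpow (X : topologicalType) (phi : homeo X X) (k : int) :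
    X -> X :=
  match k with
  | Posz m => iter m phi
  | Negz m => iter m.+1 (homeo_inv phi)
  end.

Definition distal (X : topologicalType) (phi : homeo X X) : Prop :=
  forall x y : X, x <> y ->
    closure [set (homeo_zpow phi k x, homeo_zpow phi k y) | k in [set: int]]
      `&` [set (d, d) | d in [set: X]] = set0.

(* [A] coerces to the sigma type [set_type A], which carries the subspace
   topology. *)
Section RestrictHomeo.
Variables (X : topologicalType) (phi : homeo X X) (A : set X).
Hypothesis phiA : phi @` A = A.

Let restrict_subproof (x : A) : phi (\val x) \in A.
Proof.
suff: (phi @` A) (phi (\val x)) by rewrite phiA => /mem_set.
by exists (\val x) => //; exact: set_valP.
Qed.

Let restrictV_subproof (x : A) : homeo_inv phi (\val x) \in A.
Proof.
have : A (\val x) by exact: set_valP.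
by rewrite -[X in X _ -> _]phiA => -[a Aa <-]; rewrite homeoK; exact/mem_set.
Qed.

Definition restrict_fun (x : A) : A :=
  exist (fun z => z \in A) _ (restrict_subproof x).
Definition restrict_inv (x : A) : A :=
  exist (fun z => z \in A) _ (restrictV_subproof x).

Let restrictK : cancel restrict_fun restrict_inv.
Proof. by move=> x; apply/val_inj; rewrite /= homeoK. Qed.

Let restrictVK : cancel restrict_inv restrict_fun.
Proof. by move=> x; apply/val_inj; rewrite /= homeoVK. Qed.

Let restrict_continuous_gen (f : X -> X) (g : A -> A) : continuous f ->
  (forall x, \val (g x) = f (\val x)) -> continuous g.
Proof.
move=> cf gE; apply/continuousP => _ [V oV <-].
exists (f @^-1` V); first by apply: open_comp => // x _; exact: cf.
by apply/seteqP; split => x /=; rewrite !set_valE /= gE.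
Qed.

Definition homeo_restrict : homeo A A :=
  Homeo restrictK restrictVK
    (@restrict_continuous_gen _ restrict_fun (@homeo_continuous _ _ phi)
       (fun=> erefl))
    (@restrict_continuous_gen _ restrict_inv (@homeoV_continuous _ _ phi)
       (fun=> erefl)).
End RestrictHomeo.

(* Topological groups are written additively, since all the groups considered
   are abelian. *)
Record topGroupIso (G H : topologicalZmodType) := TopGroupIso {
  iso_homeo :> homeo G H;
  isoD : {morph iso_homeo : x y / x + y} }.

Section Torus.
Variables (R : realType) (n : nat).

Definition int_lattice : {pred 'rV[R]_n} :=
  fun v => v \is a mxOver Num.int.

Let int_lattice_zmod_closed : zmod_closed int_lattice.
Proof.
split=> [|v w /mxOverP vZ /mxOverP wZ]; apply/mxOverP => i j.
  by rewrite mxE rpred0.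
by rewrite !mxE rpredB ?vZ ?wZ.
Qed.

HB.instance Definition _ :=
  GRing.isZmodClosed.Build 'rV[R]_n int_lattice int_lattice_zmod_closed.

Definition torus : Type := quotient_topology (Quotient.quot int_lattice).

HB.instance Definition _ := Topological.on torus.
HB.instance Definition _ := Quotient.on torus.
HB.instance Definition _ := GRing.isZmodule.Build torus
  (@Quotient.addqA _ int_lattice) (@Quotient.addqC _ int_lattice)
  (@Quotient.add0q _ int_lattice) (@Quotient.addNq _ int_lattice).

Let proj (v : 'rV[R]_n) : torus := \pi_torus v.

Let proj_eq v w : (v - w \in int_lattice) = (proj v == proj w).
Proof.
have -> := Quotient.idealrBE int_lattice v w.
by apply/eqP/eqP.
Qed.

Let projB v w : proj v - proj w = proj (v - w).
Proof. by rewrite /proj !piE. Qed.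

Let proj_continuous : continuous proj.
Proof. exact: pi_continuous. Qed.

Let proj_open (U : set 'rV[R]_n) : open U -> open (proj @` U).
Proof.
move=> oU; rewrite /open /= /quotient_open.
have -> : \pi_torus @^-1` (proj @` U) =
    \bigcup_(z in [set z | z \in int_lattice]) ((fun v => v - z) @^-1` U).
  apply/seteqP; split => [v /= [u Uu uv]|v [z /= zL Uv]].
    exists (v - u); last by rewrite /= opprB addrCA subrr addr0.
    by rewrite /= proj_eq; apply/eqP; rewrite uv.
  exists (v - z) => //; apply/eqP; rewrite -proj_eq.
  by rewrite addrAC subrr sub0r rpredN.
apply: bigcup_open => z _; apply: open_comp => // v _.
apply: (@continuous_comp _ _ _ (fun u => (u, z))
  (fun x : 'rV[R]_n * 'rV[R]_n => x.1 - x.2)); last exact: sub_continuous.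
exact: (@cvg_pair _ _ _ _ _ _ (nbhs_filter v) (nbhs_filter v) (nbhs_filter z)
  id (fun=> z) (@cvg_id _ _) (cvg_cst z)).
Qed.

Let torus_sub_continuous : continuous (fun x : torus * torus => x.1 - x.2).
Proof.
move=> [x y] /= U; rewrite -[x]reprK -[y]reprK; move: (repr x) (repr y) => v w.
rewrite -/(proj v) -/(proj w) projB => /proj_continuous/= UU.
have : filter_prod (nbhs v) (nbhs w)
    ((fun x => x.1 - x.2) @^-1` (proj @^-1` U)).
  exact: (@sub_continuous 'rV[R]_n (v, w) _ UU).
move=> [[V W] /= [Vv Ww] VW].
exists (proj @` V, proj @` W) => /=; first split.
- move: Vv; rewrite nbhsE => -[V' [oV' V'v] V'V]; rewrite nbhsE.
  exists (proj @` V'); last exact: image_subset.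
  by split; [exact: proj_open|exists v].
- move: Ww; rewrite nbhsE => -[W' [oW' W'w] W'W]; rewrite nbhsE.
  exists (proj @` W'); last exact: image_subset.
  by split; [exact: proj_open|exists w].
- move=> [_ _] [/= [a Va <-] [b Wb <-]]; rewrite projB.
  exact: (VW (a, b)).
Qed.

HB.instance Definition _ :=
  PreTopologicalNmodule_isTopologicalZmodule.Build torus torus_sub_continuous.

End Torus.

(* Continuous homomorphisms of Lie groups are smooth, so an isomorphism of
   topological groups with R^n / Z^n is an isomorphism of Lie groups. *)
Definition is_torus (R : realType) (n : nat) (G : topologicalZmodType) : Prop :=
  inhabited (topGroupIso (torus R n) G).

Section Chabauty.
Variable G : topologicalZmodType.

Definition closed_subgroup : set (set G) :=
  [set H | [/\ closed H, H 0 & forall x y, H x -> H y -> H (x - y)]].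

Definition Sub : Type := {H : set G | H \in closed_subgroup}.

HB.instance Definition _ := SubType.on Sub.
HB.instance Definition _ := Choice.on Sub.

Definition chabauty_misses (K : set G) : set Sub :=
  [set H | \val H `&` K = set0].

Definition chabauty_hits (U : set G) : set Sub :=
  [set H | \val H `&` U !=set0].

Definition chabauty_subbase : set (set Sub) :=
  [set chabauty_misses K | K in compact] `|` [set chabauty_hits U | U in open].

HB.instance Definition _ :=
  isSubBaseTopological.Build Sub chabauty_subbase id.

End Chabauty.
Arguments closed_subgroup : clear implicits.

Lemma homeo_imageE (X Y : topologicalType) (f : homeo X Y) (A : set X) :
  f @` A = homeo_inv f @^-1` A.
Proof.
apply/seteqP; split => [_ [x Ax <-]|y Ay] /=; first by rewrite homeoK.
by exists (homeo_inv f y) => //; rewrite homeoVK.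
Qed.

Definition homeo_sym (X Y : topologicalType) (f : homeo X Y) : homeo Y X :=
  Homeo (homeoVK f) (homeoK f) (@homeoV_continuous _ _ f)
    (@homeo_continuous _ _ f).

Lemma homeo_symD (G H : topologicalZmodType) (f : topGroupIso G H) :
  {morph homeo_sym f : x y / x + y}.
Proof.
by move=> x y; apply: (can_inj (homeoK f)); rewrite isoD /= !homeoVK.
Qed.

Definition topGroupIso_sym (G H : topologicalZmodType) (f : topGroupIso G H) :
  topGroupIso H G := TopGroupIso (@homeo_symD G H f).

Lemma isoB (G H : topologicalZmodType) (f : topGroupIso G H) :
  {morph f : x y / x - y}.
Proof. by move=> x y; apply: (addIr (f y)); rewrite -isoD !subrK. Qed.

Lemma iso_image_closed_subgroup (G H : topologicalZmodType)
    (f : topGroupIso G H) (A : Sub G) : f @` \val A \in closed_subgroup H.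
Proof.
have /set_mem [cA A0 AB] := valP A.
apply/mem_set; split.
- rewrite homeo_imageE; apply: preimage_closed cA => x _.
  exact: homeoV_continuous.
- by exists 0 => //; rewrite -(subrr (0 : G)) isoB subrr.
- move=> _ _ [x Ax <-] [y Ay <-]; exists (x - y); first exact: AB.
  by rewrite isoB.
Qed.

Definition Sub_map (G H : topologicalZmodType) (f : topGroupIso G H)
    (A : Sub G) : Sub H :=
  exist (fun B => B \in closed_subgroup H) _ (iso_image_closed_subgroup f A).

Lemma Sub_mapK (G H : topologicalZmodType) (f : topGroupIso G H) :
  cancel (Sub_map f) (Sub_map (topGroupIso_sym f)).
Proof.
move=> A; apply/val_inj; rewrite /= image_comp.
by apply: eq_image_id => x _ /=; rewrite homeoK.
Qed.

Lemma Sub_mapVK (G H : topologicalZmodType) (f : topGroupIso G H) :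
  cancel (Sub_map (topGroupIso_sym f)) (Sub_map f).
Proof.
move=> A; apply/val_inj; rewrite /= image_comp.
by apply: eq_image_id => x _ /=; rewrite homeoVK.
Qed.

Lemma chabauty_subbase_open (G : topologicalZmodType) (S : set (Sub G)) :
  chabauty_subbase S -> open S.
Proof.
move=> sS; exists [set S]; last by rewrite bigcup_set1.
by move=> _ ->; exact: finI_from1.
Qed.

Lemma chabauty_continuous (X : topologicalType) (G : topologicalZmodType)
    (g : X -> Sub G) :
  (forall K, compact K -> open (g @^-1` chabauty_misses K)) ->
  (forall U, open U -> open (g @^-1` chabauty_hits U)) -> continuous g.
Proof.
move=> gK gU; apply/continuousP => _ [D sD <-].
rewrite preimage_bigcup; apply: bigcup_open => B /sD [E sE <-].
rewrite openE => x Ex; rewrite /interior preimage_bigcap.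
apply: filter_bigI => S SE; apply: open_nbhs_nbhs; split; last exact: Ex.
by have /set_mem [[K cK <-]|[U oU <-]] := sE _ SE; [exact: gK|exact: gU].
Qed.

Lemma chabauty_misses_open (G : topologicalZmodType) (K : set G) :
  compact K -> open (chabauty_misses K).
Proof. by move=> cK; apply: chabauty_subbase_open; left; exists K. Qed.

Lemma chabauty_hits_open (G : topologicalZmodType) (U : set G) :
  open U -> open (chabauty_hits U).
Proof. by move=> oU; apply: chabauty_subbase_open; right; exists U. Qed.

Lemma Sub_map_continuous (G H : topologicalZmodType) (f : topGroupIso G H) :
  continuous (Sub_map f).
Proof.
apply: chabauty_continuous => [K cK|U oU].
- suff -> : Sub_map f @^-1` chabauty_misses K =
      chabauty_misses (homeo_sym f @` K).
    apply/chabauty_misses_open/continuous_compact => //.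
    exact/continuous_subspaceT/homeo_continuous.
  rewrite homeo_imageE; apply/seteqP; split => A /= /seteqP[+ _] => AK;
    apply/seteqP; split => // x.
  + by move=> [Ax Kx]; apply: (AK (f x)); split => //; exists x.
  + by move=> [[y Ay <-] Ky]; apply: (AK y).
- suff -> : Sub_map f @^-1` chabauty_hits U = chabauty_hits (f @^-1` U).
    by apply/chabauty_hits_open/open_comp => // x _; exact: homeo_continuous.
  apply/seteqP; split => A /=.
  + by move=> [_ [[x Ax <-] Ux]]; exists x.
  + by move=> [x [Ax Ux]]; exists (f x); split => //; exists x.
Qed.

Definition Sub_homeo (G H : topologicalZmodType) (f : topGroupIso G H) :
    homeo (Sub G) (Sub H) :=
  Homeo (Sub_mapK f) (Sub_mapVK f)
    (@Sub_map_continuous _ _ f) (@Sub_map_continuous _ _ (topGroupIso_sym f)).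

Section OneParameter.
Variables (R : realType) (G : topologicalZmodType).

Definition one_parameter_subgroup : set (set G) :=
  [set range phi | phi in
    [set phi : R -> G | continuous phi /\ {morph phi : s t / s + t}]].

(* Only closed one-parameter subgroups occur here, as [\val H] is closed. *)
Definition Subp : set (Sub G) :=
  smallest closed [set H : Sub G | one_parameter_subgroup (\val H)].

End OneParameter.
Arguments one_parameter_subgroup : clear implicits.
Arguments Subp : clear implicits.

Lemma Subp_image_sub (R : realType) (G H : topologicalZmodType)
    (f : topGroupIso G H) : Sub_homeo f @` Subp R G `<=` Subp R H.
Proof.
move=> _ [A SA <-] C [cC sC].
apply: (SA (Sub_homeo f @^-1` C)); split.
  by apply: preimage_closed cC => x _; exact: homeo_continuous.
move=> B [phi [cphi phiD] phiB]; apply: sC.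
exists (f \o phi); last by rewrite /= -phiB image_comp.
split; last by move=> s t /=; rewrite phiD isoD.
by move=> t; apply: continuous_comp; [exact: cphi|exact: homeo_continuous].
Qed.

Lemma Subp_invariant (R : realType) (G : topologicalZmodType)
    (T : topGroupIso G G) : Sub_homeo T @` Subp R G = Subp R G.
Proof.
apply/seteqP; split; first exact: Subp_image_sub.
move=> A SA; exists (Sub_homeo (topGroupIso_sym T) A).
  by apply: (@Subp_image_sub R G G (topGroupIso_sym T)); exists A.
exact: (Sub_mapVK T).
Qed.

Definition acts_distally_on_Subp (R : realType) (G : topologicalZmodType)
    (T : topGroupIso G G) : Prop :=
  distal (homeo_restrict (@Subp_invariant R G T)).

(* Main.v *)
From HB Require Import structures.
From mathcomp Require Import all_boot all_order all_algebra.
From mathcomp Require Import lra.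
From mathcomp Require Import all_classical all_reals all_analysis.
Require Import Defs.
Import numFieldNormedType.Exports.
Import Order.TTheory GRing.Theory Num.Theory.

Set Implicit Arguments.
Unset Strict Implicit.
Unset Printing Implicit Defensive.

Local Open Scope classical_set_scope.
Local Open Scope ring_scope.
Local Open Scope quotient_scope.

(** If [T^m] is the identity, so is the [m]-th power of the induced map on
    closed subgroups; all orbits of pairs are then finite, and finite sets are
    closed because the Chabauty space is T1 ([finite_order_distal]).

    Conversely, let [T] act distally. The Chabauty space of a compact Hausdorff
    group is compact Hausdorff ([Sub_compact], [Sub_hausdorff]), and a distal
    homeomorphism of a compact Hausdorff space brings every point back
    arbitrarily close to itself at some positive time ([distal_recurrent]): by
    the Ellis-Numakura lemma ([ellis_numakura]) its positive powers have an
    idempotent pointwise limit [u], every [x] is proximal to [u x], and so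
    [u x = x].

    Recurrence is applied to the [n] coordinate circles of [G = R^n / Z^n]. They
    are rigid: by the linear form of one-parameter subgroups ([hom_lift]), an
    injective homomorphism from the circle to [G] whose image stays in a small
    tube around a coordinate circle is plus or minus the inclusion of that
    circle ([hom_into_tube]). Hence a circle that returns close to itself under
    [T^k] is mapped to itself by [1] or [-1], and [T^(2k)] fixes it pointwise
    ([distal_axis_periodic]). The circles generate [G], so a common multiple of
    these periods is a period of [T] ([distal_finite_order]). *)

(** * Idempotents in compact semigroups *)

(** A chain of open sets is directed, so a finite subcover is absorbed by one of
    its members. *)
Lemma compact_chain_cover (X : topologicalType) (A : set X)
    (F : set (set X)) : compact A -> F !=set0 -> total_on F subset ->
  F `<=` open -> A `<=` \bigcup_(W in F) W -> exists2 W, F W & A `<=` W.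
Proof.
move=> /compact_near_coveringP cA F0 Ftot Fo AF.
(* The filter of tails of the chain turns near-covering into the choice of one
   large member. *)
pose tails := filter_from F (fun W => [set V | F V /\ W `<=` V]).
have tailsF : Filter tails.
  apply: filter_from_filter => // V W FV FW.
  have [VW|WV] := Ftot _ _ FV FW.
    by exists W => // U [FU WU]; split; split => //; exact: subset_trans WU.
  by exists V => // U [FU VU]; split; split => //; exact: subset_trans VU.
have [|W FW] := cA _ tails (fun W x => W x) tailsF.
  move=> x /AF[W FW Wx]; exists (W, [set V | F V /\ W `<=` V]) => /=.
    split; last by exists W.
    by apply: open_nbhs_nbhs; split => //; exact: Fo.
  by move=> [y V] /= [Wy [_]]; exact.
by move=> /(_ W (conj FW (@subset_refl _ W))); exists W.
Qed.

Section EllisNumakura.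
Variables (X : topologicalType) (op : X -> X -> X).
Hypotheses (hX : hausdorff_space X) (opA : associative op)
  (op_cont : forall s, continuous (op ^~ s)).

Let stable (S : set X) := forall s t, S s -> S t -> S (op s t).

(** Zorn's lemma is used on the open sets whose complements in [A] are nonempty
    subsemigroups, so that a maximal one yields a minimal closed
    subsemigroup. *)
Let minimal_subsemigroup (A : set X) : compact A -> A !=set0 -> stable A ->
  exists S, [/\ S `<=` A, compact S, S !=set0, stable S &
    forall S', closed S' -> S' !=set0 -> stable S' -> S' `<=` S -> S `<=` S'].
Proof.
move=> cA A0 sA.
pose P (W : set X) := [/\ open W, A `\` W !=set0 & stable (A `\` W)].
have [F FP Ftot|W [[oW W0 sW] Wmax]] := @Zorn_bigcup _ P.
  have [->|/set0P F0] := eqVneq F set0.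
    by rewrite /P bigcup_set0 setD0; split => //; exact: open0.
  split; first by apply: bigcup_open => W /FP[].
    apply/set0P/negP => /eqP; rewrite setD_eq0 => AF.
    have [|W /FP[_ [x [Ax Wx]] _]] := compact_chain_cover cA F0 Ftot _ AF.
      by move=> W /FP[].
    by move=> /(_ x Ax).
  move=> s t [As Fs] [At Ft]; split; first exact: sA.
  move=> [W FW Wst]; have [_ _ sAW] := FP W FW.
  have AW x : A x -> ~ (\bigcup_(W in F) W) x -> (A `\` W) x.
    by move=> Ax Fx; split => // Wx; apply: Fx; exists W.
  by have [_] := sAW _ _ (AW _ As Fs) (AW _ At Ft).
exists (A `\` W); split => //.
  apply: (subclosed_compact _ cA); last by move=> ? [].
  by rewrite setDE; apply: closedI; [exact: compact_closed|exact: open_closedC].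
move=> S' cS' S'0 sS' S'S x [Ax Wx]; apply: contrapT => S'x.
have S'E : A `\` ~` S' = S'.
  by rewrite setDE setCK; apply/seteqP; split=> [y []//|y S'y];
    split => //; case: (S'S _ S'y).
apply: (Wmax (~` S')); last by split; rewrite ?S'E//; exact: closed_openC.
split=> [y Wy S'y|/(_ x S'x)//]; by case: (S'S _ S'y).
Qed.

(** The Ellis-Numakura lemma. In a minimal closed subsemigroup [S] with [s] in
    it, both [S s] and the stabilizer of [s] in [S], the set of [t] with
    [t s = s], are closed subsemigroups, hence equal to [S]: the first equality
    makes the stabilizer nonempty, the second puts [s] itself in it. Only right
    translations have to be continuous, which is all that composition of
    arbitrary maps offers. *)
Lemma ellis_numakura (A : set X) : compact A -> A !=set0 ->
  (forall s t, A s -> A t -> A (op s t)) -> exists2 u, A u & op u u = u.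
Proof.
move=> cA A0 sA.
have [S [SA cS [s Ss] sS Smin]] := minimal_subsemigroup cA A0 sA.
have [t St ts] : ((op ^~ s) @` S) s.
  apply: (Smin ((op ^~ s) @` S)) => //.
  - apply: compact_closed => //; apply: continuous_compact => //.
    exact: continuous_subspaceT.
  - by exists (op s s), s.
  - move=> _ _ [a Sa <-] [b Sb <-]; exists (op (op a s) b); last by rewrite opA.
    by apply: (sS) => //; exact: sS.
  - by move=> _ [a Sa <-]; exact: sS.
have [_ ss] : (S `&` (op ^~ s) @^-1` [set s]) s.
  apply: (Smin (S `&` (op ^~ s) @^-1` [set s])) => //.
  - apply: closedI; first exact: compact_closed.
    apply: preimage_closed; first by move=> ? _; exact: op_cont.
    exact/accessible_closed_set1/hausdorff_accessible.
  - by exists t.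
  - by move=> a b [Sa /= as_] [Sb /= bs]; split; [exact: sS|rewrite /= -opA bs].
by exists s => //; exact: SA.
Qed.

End EllisNumakura.

(** * Recurrence of distal homeomorphisms *)

Lemma closure_min (X : topologicalType) (A B : set X) :
  closed B -> A `<=` B -> closure A `<=` B.
Proof. by move=> /closure_id BE AB; rewrite BE; exact: closureS. Qed.

Lemma ptws_proj_continuous (X Y : topologicalType) (x : X) :
  continuous (fun f : {ptws X -> Y} => f x).
Proof. exact: (@proj_continuous X (fun=> Y) x). Qed.

Lemma continuous_to_ptws (Z X Y : topologicalType) (h : Z -> {ptws X -> Y}) :
  (forall x, continuous (fun z => h z x)) -> continuous h.
Proof.
move=> hc z; apply/cvg_sup => x U [_ [[V oV <-] /= Vhz VU]].
apply: filterS VU _; apply: (hc x z).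
by apply: open_nbhs_nbhs; split.
Qed.

Lemma homeo_iter_continuous (X : topologicalType) (phi : homeo X X) k :
  continuous (iter k phi).
Proof.
elim: k => [|k IHk] x /=; first exact: cvg_id.
by apply: continuous_comp; [exact: IHk|exact: homeo_continuous].
Qed.

Lemma homeo_iter_inj (X : topologicalType) (phi : homeo X X) k :
  injective (iter k phi).
Proof. by elim: k => // k IHk x y /= /(can_inj (homeoK phi))/IHk. Qed.

Section DistalRecurrence.
Variables (X : topologicalType) (phi : homeo X X).
Hypotheses (hX : hausdorff_space X) (cX : compact [set: X]).

(** Starting at exponent 1 is what makes the recurrence below nontrivial: the
    identity is not put into the semigroup by hand. *)
Let powers : set {ptws X -> X} := [set iter k.+1 phi | k in [set: nat]].

(** Composition is continuous in its left argument for pointwise convergence,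
    but in its right argument only when the left one is continuous; so the
    closure is taken first in [g], against the powers of [phi], and then in
    [f]. *)
Let closure_powers_comp (f g : {ptws X -> X}) :
  closure powers f -> closure powers g -> closure powers (f \o g).
Proof.
move=> + Eg; pose post (h : {ptws X -> X}) : {ptws X -> X} := h \o g.
have post_cont : continuous post.
  by apply: continuous_to_ptws => x; exact: ptws_proj_continuous.
have : closed (post @^-1` closure powers).
  apply: preimage_closed; last exact: closed_closure.
  by move=> h _; exact: post_cont.
move=> /closure_min; apply => _ [k _ <-].
pose pre (h : {ptws X -> X}) : {ptws X -> X} := iter k.+1 phi \o h.
have pre_cont : continuous pre.
  apply: continuous_to_ptws => x h.
  exact: (@continuous_comp {ptws X -> X} X X (fun h => h x) (iter k.+1 phi) h
    (@ptws_proj_continuous X X x h) (@homeo_iter_continuous X phi k.+1 _)).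
have : closed (pre @^-1` closure powers).
  apply: preimage_closed; last exact: closed_closure.
  by move=> h _; exact: pre_cont.
move=> /closure_min/(_ _ _ Eg); apply => _ [l _ <-].
apply: subset_closure; exists (k + l.+1)%N => //.
by apply/funext => x; rewrite -addSn iterD.
Qed.

(** If [u] is an idempotent limit of positive powers of [phi], then the pairs
    [(phi^k x, phi^k (u x))] accumulate at the diagonal point [(u x, u x)].
    Distality thus forces [u x = x], and [x] is a limit of its own forward
    orbit. *)
Lemma distal_recurrent : distal phi -> forall (x : X) (U : set X),
  nbhs x U -> exists k, (0 < k)%N /\ U (iter k phi x).
Proof.
move=> dphi x U xU.
have cE : compact (closure powers).
  apply: (subclosed_compact (@closed_closure _ _) _ (@subsetT _ _)).
  have := @tychonoff X (fun=> X) (fun=> setT) (fun=> cX).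
  by congr compact; apply/seteqP; split.
have [u Eu uu] : exists2 u, closure powers u & u \o u = u.
  apply: (@ellis_numakura {ptws X -> X} (fun f g => f \o g)) => //.
  - exact: (@hausdorff_product X (fun=> X)).
  - by move=> g; apply: continuous_to_ptws => y; exact: ptws_proj_continuous.
  - by exists (iter 1 phi); apply: subset_closure; exists 0%N.
have near_u (V : set X) (y : X) W : nbhs (u x) V -> nbhs (u y) W ->
    exists k, V (iter k.+1 phi x) /\ W (iter k.+1 phi y).
  move=> uV uW; have [|_ [[k _ <-] [Vk Wk]]] := Eu
    ((fun f : {ptws X -> X} => f x) @^-1` V `&`
     (fun f : {ptws X -> X} => f y) @^-1` W); last by exists k.
  by apply: filterI; [exact: (@ptws_proj_continuous X X x u _ uV)
    |exact: (@ptws_proj_continuous X X y u _ uW)].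
have [ux|ux] := pselect (x = u x); last first.
  exfalso; move: (dphi _ _ ux) => /seteqP[/(_ (u x, u x)) + _]; apply.
  split; last by exists (u x).
  move=> W [[V V'] /= [uV uV'] VW].
  have uux : u (u x) = u x by rewrite -[in RHS]uu.
  have [k [Vk V'k]] := near_u V (u x) V' uV ltac:(by rewrite uux).
  exists (iter k.+1 phi x, iter k.+1 phi (u x)); split; last exact: VW.
  by exists (Posz k.+1).
rewrite ux in xU; have [k [Uk _]] := near_u U x setT xU filterT.
by exists k.+1.
Qed.

End DistalRecurrence.

(** * The Chabauty space *)

Section Chabauty.
Variable G : topologicalZmodType.

Lemma Sub_closed (H : Sub G) : closed (\val H).
Proof. by have /set_mem[] := valP H. Qed.

Lemma Sub0 (H : Sub G) : (\val H) 0.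
Proof. by have /set_mem[] := valP H. Qed.

Lemma SubB (H : Sub G) x y : (\val H) x -> (\val H) y -> (\val H) (x - y).
Proof. by have /set_mem[_ _] := valP H; exact. Qed.

Lemma chabauty_cvg (F : set_system (Sub G)) (L : Sub G) : Filter F ->
  (forall K, compact K -> chabauty_misses K L -> F (chabauty_misses K)) ->
  (forall U, open U -> chabauty_hits U L -> F (chabauty_hits U)) -> F --> L.
Proof.
move=> FF FK FU A; rewrite nbhsE => -[B [[D sD <-] [C DC CL]] BA].
apply: filterS BA _; apply: (filterS (P := C)); first by move=> H CH; exists C.
have [E sE EC] := sD _ DC; rewrite -EC in CL *.
apply: filter_bigI => S SE; have SL := CL _ SE.
by have /set_mem[[K cK KS]|[U oU US]] := sE _ SE; rewrite -?KS -?US in SL *;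
  [exact: FK|exact: FU].
Qed.

(** The limit of an ultrafilter [F] of closed subgroups consists of the points
    all of whose neighbourhoods are hit by [F]-almost all subgroups. *)
Lemma Sub_compact : compact [set: Sub G].
Proof.
rewrite compact_ultra => F FU _.
pose L := [set x : G | forall U, open U -> U x -> F (chabauty_hits U)].
have L_subgroup : L \in closed_subgroup G.
  apply/mem_set; split.
  - move=> x clx U oU Ux.
    have [y [Ly Uy]] := clx U (open_nbhs_nbhs (conj oU Ux)).
    exact: Ly.
  - move=> U oU U0; apply: filterS filterT => H _.
    by exists 0; split => //; exact: Sub0.
  - move=> x y Lx Ly U oU Uxy.
    have [[V W] /= [Vx Wy] VW] := @sub_continuous G (x, y) U
      (open_nbhs_nbhs (conj oU Uxy)).
    have FV : F (chabauty_hits V°).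
      by apply: Lx; [exact: open_interior|exact: Vx].
    have FW : F (chabauty_hits W°).
      by apply: Ly; [exact: open_interior|exact: Wy].
    apply: filterS (filterI FV FW) => H [[a [Ha /interior_subset Va]]].
    move=> [b [Hb /interior_subset Wb]].
    by exists (a - b); split; [exact: SubB|exact: (VW (a, b))].
exists (exist _ L L_subgroup); split => //; apply: chabauty_cvg.
- move=> K /compact_near_coveringP cK LK.
  have /(_ _) cK' := cK _ F (fun H x => ~ (\val H) x) _.
  apply: filterS (cK' _) => [H KH|x Kx].
    by apply/seteqP; split => // x [Hx Kx]; exact: (KH x Kx).
  have : ~ L x by move=> Lx; have /seteqP[/(_ x) + _] := LK; exact.
  move=> /existsNP[U /not_implyP[oU /not_implyP[Ux nFU]]].
  have [//|FnU] := in_ultra_setVsetC (chabauty_hits U) FU.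
  exists (U, ~` chabauty_hits U) => /=.
    by split => //; apply: open_nbhs_nbhs.
  by move=> [y H] /= [Uy HU] Hy; apply: HU; exists y.
- by move=> U oU [x [Lx Ux]]; exact: Lx.
Qed.

Lemma Sub_accessible : accessible_space (Sub G).
Proof.
move=> H L HL.
have [|] := pselect (\val H `<=` \val L); last first.
  move=> /existsNP[x /not_implyP[Hx Lx]]; exists (chabauty_hits (~` \val L)).
  split; first exact/chabauty_hits_open/closed_openC/Sub_closed.
    by apply/mem_set; exists x.
  by apply/mem_set => -[y []].
have [|] := pselect (\val L `<=` \val H).
  move=> LH HL'; exfalso; move/eqP: HL; apply; apply/val_inj.
  exact/seteqP.
move=> /existsNP[x /not_implyP[Lx Hx]] _; exists (chabauty_misses [set x]).
split; first exact/chabauty_misses_open/compact_set1.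
  by apply/mem_set/seteqP; split => // y [Hy yx]; rewrite yx in Hy.
by apply/mem_set => /seteqP[/(_ x) + _]; exact.
Qed.

(** A point of [H] outside [L] has a neighbourhood whose closure is compact and
    misses [L]; hitting the former and missing the latter are disjoint open
    conditions. *)
Lemma Sub_hausdorff : compact [set: G] -> hausdorff_space G ->
  hausdorff_space (Sub G).
Proof.
move=> cG hG.
have sep (H L : Sub G) x : (\val H) x -> ~ (\val L) x ->
    exists A B, [/\ open A, open B, A H, B L & A `&` B = set0].
  move=> Hx Lx.
  have [V xV VL] : filter_from (nbhs x) closure (~` \val L).
    apply: (compact_regular hG cG filterT).
    by apply: open_nbhs_nbhs; split => //; exact/closed_openC/Sub_closed.
  exists (chabauty_hits V°), (chabauty_misses (closure V)).
  split; first exact/chabauty_hits_open/open_interior.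
  - apply: chabauty_misses_open.
    exact: (subclosed_compact (@closed_closure _ _) cG).
  - by exists x.
  - by apply/seteqP; split => // y [Ly /VL].
  - apply/seteqP; split => // K [[y [Ky Vy]] /seteqP[/(_ y) KV _]].
    apply: KV; split => //.
    by apply: subset_closure; exact: interior_subset.
rewrite open_hausdorff => H L HL.
have [|] := pselect (\val H `<=` \val L); last first.
  move=> /existsNP[x /not_implyP[Hx Lx]].
  have [A [B [oA oB AH BL AB]]] := sep H L x Hx Lx.
  exists (A, B); split => //=; rewrite ?AB//; exact/mem_set.
have [|] := pselect (\val L `<=` \val H).
  move=> LH HL'; exfalso; move/eqP: HL; apply; apply/val_inj.
  exact/seteqP.
move=> /existsNP[x /not_implyP[Lx Hx]] _.
have [A [B [oA oB AL BH AB]]] := sep L H x Lx Hx.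
exists (B, A); split => //=; rewrite 1?setIC ?AB//; exact/mem_set.
Qed.

End Chabauty.

Section Subtype.
Variables (X : topologicalType) (A : set X).

Lemma set_val_continuous : continuous (set_val : A -> X).
Proof. exact: initial_continuous. Qed.

Lemma set_type_hausdorff : hausdorff_space X -> hausdorff_space A.
Proof.
move=> hX x y xy; apply: val_inj; apply: hX => U V xU yV.
have [z [Uz Vz]] := xy _ _ (@set_val_continuous x U xU)
  (@set_val_continuous y V yV).
by exists (set_val z).
Qed.

Lemma set_type_compact : compact A -> compact [set: A].
Proof.
move=> cA F FF _; have FA : (set_val @ F) A.
  by apply: (@filterS _ F _ setT) filterT => x _; exact: set_valP.
have [x [Ax Fx]] := cA (set_val @ F) _ FA.
exists (SigSub (mem_set Ax)); split => // B U FB [_ [[V oV <-] /= Vx VU]].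
have FB' : (set_val @ F) (set_val @` B).
  by apply: (@filterS _ F _ B) FB => b Bb; exists b.
have [_ [[b Bb <-] Vb]] := Fx _ _ FB' (open_nbhs_nbhs (conj oV Vx)).
by exists b; split => //; exact: VU.
Qed.

End Subtype.

(** * The universal covering of a torus *)

Section IntegerLattice.
Variable R : realType.

Lemma small_int_eq0 (x : R) : x \is a Num.int -> `|x| < 1 -> x = 0.
Proof.
move=> xZ x1; apply/eqP; apply/negPn/negP => /(norm_intr_ge1 xZ).
by rewrite leNgt x1.
Qed.

Lemma closed_int_num : closed [set x : R | x \is a Num.int].
Proof.
rewrite -[X in closed X]setCK; apply: open_closedC; rewrite openE => x xNZ.
have [fx xf] := andP (floor_itv x).
have {}fx : (Num.floor x)%:~R < x.
  rewrite lt_neqAle fx andbT; apply/negP => /eqP xE.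
  by apply: xNZ; rewrite /= -xE intr_int.
have : x \in `](Num.floor x)%:~R, (Num.floor x + 1)%:~R[.
  by rewrite in_itv/= fx xf.
move=> /near_in_itvoo; apply: filterS => y.
rewrite in_itv/= => /andP[fy yf] /= /intrP[m yE].
by move: fy yf; rewrite yE !ltr_int ltzD1 ltNge => /negbTE ->.
Qed.

Lemma closed_int_lattice n : closed [set v : 'rV[R]_n | v \is a mxOver Num.int].
Proof.
have -> : [set v : 'rV[R]_n | v \is a mxOver Num.int] =
    \bigcap_i ((fun v : 'rV[R]_n => v 0 i) @^-1` [set x | x \is a Num.int]).
  apply/seteqP; split=> [v /mxOverP vZ i _ |v vZ]; first exact: vZ.
  by apply/mxOverP => i j; rewrite ord1; exact: (vZ j).
apply: closed_bigI => i _; apply: preimage_closed; last exact: closed_int_num.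
by move=> v _; exact: coord_continuous.
Qed.

End IntegerLattice.

(** The universal covering of a torus, kept as a bare list of properties so that
    the rest of the argument takes place in [R^n] and in [G]. *)
Definition torus_covering (R : realType) (n : nat) (G : topologicalZmodType)
    (p : 'rV[R]_n -> G) : Prop :=
  [/\ continuous p, forall U, open U -> open (p @` U), {morph p : v w / v - w},
      forall x, exists v, p v = x &
      forall v, p v = 0 <-> v \is a mxOver Num.int].

Lemma is_torus_covering (R : realType) (n : nat) (G : topologicalZmodType) :
  is_torus R n G -> exists p : 'rV[R]_n -> G, torus_covering p.
Proof.
move=> [phi]; pose q (v : 'rV[R]_n) : torus R n := \pi_(torus R n) v.
have q_eq v w : q v = q w <-> v - w \is a mxOver Num.int.
  have -> : (v - w \is a mxOver Num.int) = (v - w \in @int_lattice R n) by [].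
  rewrite (Quotient.idealrBE (@int_lattice R n) v w).
  by split=> [qE|/eqP //]; apply/eqP.
have qB v w : q (v - w) = q v - q w by rewrite /q !piE.
have q_open U : open U -> open (q @` U).
  move=> oU; rewrite /open /= /quotient_open.
  have -> : \pi_(torus R n) @^-1` (q @` U) =
      \bigcup_(z in [set z | z \is a mxOver Num.int])
         ((fun v => v - z) @^-1` U).
    apply/seteqP; split => [v /= [u Uu /q_eq uv]|v [z zL Uv]].
      exists (v - u); last by rewrite /= opprB addrC subrK.
      by rewrite /= -opprB (rpredN (@int_lattice R n)).
    exists (v - z) => //; apply/q_eq.
    by rewrite addrAC subrr sub0r (rpredN (@int_lattice R n)).
  apply: bigcup_open => z _; apply: open_comp => // v _.
  by apply: continuousB; [exact: cvg_id|exact: cst_continuous].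
exists (phi \o q); split.
- move=> v; apply: continuous_comp; first exact: pi_continuous.
  exact: homeo_continuous.
- move=> U oU; rewrite -image_comp homeo_imageE.
  apply: open_comp; last exact: q_open.
  by move=> x _; exact: homeoV_continuous.
- by move=> v w /=; rewrite qB isoB.
- by move=> x; exists (repr (homeo_inv phi x)); rewrite /= /q reprK homeoVK.
- move=> v; rewrite -{2}[v]subr0 -q_eq.
  have q0 : q 0 = 0 by rewrite -(subrr (0 : 'rV[R]_n)) qB subrr.
  have phi0 : phi 0 = 0 by rewrite -(subrr (0 : torus R n)) isoB subrr.
  rewrite /= q0; split=> [|->//]; rewrite -phi0.
  exact: (can_inj (homeoK phi)).
Qed.

Section SubMorphism.
Variables (U V : zmodType) (f : U -> V).
Hypothesis fB : {morph f : x y / x - y}.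

Let f_additive : {additive U -> V} :=
  HB.pack f (GRing.isZmodMorphism.Build U V f fB).

Lemma morph_sub0 : f 0 = 0.
Proof. exact: (raddf0 f_additive). Qed.

Lemma morph_subD : {morph f : x y / x + y}.
Proof. exact: (raddfD f_additive). Qed.

Lemma morph_subMz m : {morph f : x / x *~ m}.
Proof. exact: (raddfMz f_additive). Qed.

End SubMorphism.

Lemma normr_coord_le (R : realType) (n : nat) (v : 'rV[R]_n) i :
  `|v 0 i| <= `|v|.
Proof.
rewrite [leRHS]/Num.Def.normr /= mx_normrE.
by apply/bigmax_geP; right; exists (0, i).
Qed.

Section Covering.
Variables (R : realType) (n : nat) (G : topologicalZmodType).
Variable p : 'rV[R]_n -> G.
Hypothesis p_cov : torus_covering p.

Let p_cont : continuous p. Proof. by have [h _ _ _ _] := p_cov. Qed.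
Let p_open U : open U -> open (p @` U).
Proof. by have [_ + _ _ _] := p_cov; exact. Qed.
Let pB : {morph p : v w / v - w}. Proof. by have [_ _ h _ _] := p_cov. Qed.
Let p_surj x : exists v, p v = x. Proof. by have [_ _ _ h _] := p_cov. Qed.
Let p_ker v : p v = 0 <-> v \is a mxOver Num.int.
Proof. by have [_ _ _ _ h] := p_cov. Qed.

Lemma covering_closed0 : closed [set (0 : G)].
Proof.
rewrite -[X in closed X]setCK; apply: open_closedC.
have -> : ~` [set (0 : G)] = p @` (~` [set v | v \is a mxOver Num.int]).
  apply/seteqP; split=> [x x0|_ [v vNZ <-]]; last by move=> /p_ker.
  by have [v vx] := p_surj x; exists v => // /p_ker; rewrite vx.
by apply: p_open; apply: closed_openC; exact: closed_int_lattice.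
Qed.

Lemma covering_hausdorff : hausdorff_space G.
Proof.
move=> x y xy; apply: contrapT => nxy.
have xy0 : nbhs (x - y) (~` [set (0 : G)]).
  apply: open_nbhs_nbhs; split; first exact/closed_openC/covering_closed0.
  by move=> /eqP; rewrite subr_eq0 => /eqP.
have [[V W] /= [Vx Wy] VW] := @sub_continuous G (x, y) _ xy0.
by have [z [Vz Wz]] := xy V W Vx Wy; apply: (VW (z, z)) => //=; rewrite subrr.
Qed.

Lemma covering_compact : compact [set: G].
Proof.
pose cube := [set v : 'rV[R]_n | forall i, `[0, 1]%classic (v ord0 i)].
have -> : [set: G] = p @` cube.
  apply/seteqP; split => // x _; have [v <-] := p_surj x.
  pose fl : 'rV[R]_n := \row_j (Num.floor (v 0 j))%:~R.
  exists (v - fl).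
    move=> j; rewrite /= in_itv/= !mxE.
    have /andP[] := floor_itv (v 0 j).
    by rewrite intrD => ? ?; apply/andP; split; lra.
  rewrite pB; have -> : p fl = 0; last by rewrite subr0.
  by apply/p_ker/mxOverP => i j; rewrite mxE intr_int.
apply: continuous_compact; first exact: continuous_subspaceT.
exact: (@rV_compact R n (fun=> `[0, 1]%classic)
  (fun=> @segment_compact R 0 1)).
Qed.

Lemma expr_half_cvg0 : (fun j => 2^-1 ^+ j : R) @ \oo --> (0 : R).
Proof. by apply: cvg_expr; rewrite ger0_norm; lra. Qed.

(** By additivity [g] vanishes on all dyadic numbers, which are dense. *)
Lemma dyadic_hom_eq0 (g : R -> G) (J : nat) : continuous g ->
  {morph g : s t / s - t} ->
  (forall j, (J <= j)%N -> g (2^-1 ^+ j) = 0) -> forall t, g t = 0.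
Proof.
move=> gc gB g0 t.
have cK : closed (g @^-1` [set 0]).
  by apply: preimage_closed; [move=> ? _; exact: gc|exact: covering_closed0].
pose a j : R := (Num.floor (t * 2 ^+ j))%:~R * 2^-1 ^+ j.
have at_cvg : a j @[j --> \oo] --> t.
  apply/cvgrPdist_le => e e0.
  have := expr_half_cvg0 => /cvgrPdist_le/(_ e e0).
  apply: filterS => j; rewrite sub0r normrN => je.
  apply: le_trans je; have j0 : (0 : R) < 2 ^+ j by apply: exprn_gt0.
  have -> : t - a j = (t * 2 ^+ j - (Num.floor (t * 2 ^+ j))%:~R) * 2^-1 ^+ j.
    by rewrite mulrBl -mulrA -exprMn divff ?expr1n ?mulr1 // pnatr_eq0.
  rewrite normrM ler_piMl //.
  have /andP[] := floor_itv (t * 2 ^+ j); rewrite intrD => h1 h2.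
  by rewrite ger0_norm; lra.
apply: (closed_cvg _ cK _ _ at_cvg); exists J => // j /= Jj.
by rewrite /a mulrzl (morph_subMz gB) g0 // mul0rz.
Qed.

(** One-parameter subgroups of a torus are linear. Near [0] the values
    [f (2^-j)] have representatives of norm less than [1/4]. Twice the
    representative at [j + 1] differs from the one at [j] by an integer vector
    of norm less than [1], hence by [0]; so the representatives are [2^-j w] for
    a single vector [w]. *)
Lemma hom_lift (f : R -> G) : continuous f -> {morph f : s t / s - t} ->
  exists w, forall t, f t = p (t *: w).
Proof.
move=> fc fB.
have p0 := morph_sub0 pB; have f0 := morph_sub0 fB.
have W0 : nbhs (f 0) (p @` (ball (0 : 'rV[R]_n) 4^-1)).
  apply: open_nbhs_nbhs; split; last by exists 0; [exact: ballxx|rewrite p0].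
  by apply: p_open; exact: ball_open.
have [J _ HJ] := expr_half_cvg0 (fc 0 _ W0).
have /choice[v vP] : forall j, exists v, (J <= j)%N ->
    f (2^-1 ^+ j) = p v /\ `|v| < 4^-1.
  move=> j; have [/HJ[v /= v4 vE]|] := leqP J j; last by exists 0.
  exists v => _; split=> //.
  by move: v4; rewrite -ball_normE /= sub0r normrN.
have v_half j : (J <= j)%N -> v j.+1 *+ 2 = v j.
  move=> Jj; have [fj vj] := vP j Jj; have [fj1 vj1] := vP j.+1 (leqW Jj).
  apply/eqP; rewrite -subr_eq0; apply/eqP/rowP => i; rewrite [RHS]mxE.
  have /mxOverP/(_ 0 i) : v j.+1 *+ 2 - v j \is a mxOver Num.int.
    apply/p_ker; rewrite pB mulr2n (morph_subD pB) -fj -fj1 -(morph_subD fB).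
    rewrite exprS -mulrDl -fB (_ : 2^-1 + 2^-1 = 1 :> R); last by lra.
    by rewrite mul1r subrr.
  move=> /small_int_eq0; apply.
  apply: le_lt_trans (_ : `|v j.+1 *+ 2 - v j| < 1).
    exact: normr_coord_le.
  apply: le_lt_trans (ler_normB _ _) _; rewrite mulr2n.
  by have := ler_normD (v j.+1) (v j.+1); lra.
pose w := 2 ^+ J *: v J; exists w.
have vE i : v (J + i)%N = 2^-1 ^+ (J + i) *: w.
  elim: i => [|i IHi].
    by rewrite addn0 /w scalerA -exprMn mulVf ?expr1n ?scale1r // pnatr_eq0.
  rewrite addnS exprS -scalerA -IHi -(v_half (J + i)%N) ?leq_addr //.
  by rewrite -(scaler_nat 2 (v _)) scalerA mulVf ?scale1r // pnatr_eq0.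
move=> t; apply/eqP; rewrite -subr_eq0; apply/eqP.
apply: (@dyadic_hom_eq0 (fun t => f t - p (t *: w)) J).
- move=> s; apply: (@continuous_comp _ _ _ (fun s => (f s, p (s *: w)))
    (fun x : G * G => x.1 - x.2)); last exact: sub_continuous.
  apply: cvg_pair; first exact: fc.
  apply: continuous_comp; last exact: p_cont.
  exact: scalel_continuous.
- move=> a b /=; rewrite fB scalerBl pB opprD opprK addrACA opprB.
  by rewrite [- _ + _]addrC.
- move=> j Jj; have [-> _] := vP j Jj; rewrite -{1}(subnKC Jj) vE subnKC //.
  exact: subrr.
Qed.

(** * Coordinate circles *)

Definition axis_hom (i : 'I_n) (t : R) : G := p (t *: delta_mx 0 i).

(** A neighbourhood of the [i]-th coordinate circle that contains no
    one-parameter subgroup leaving the circle. *)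
Definition axis_tube (i : 'I_n) : set G :=
  p @` ((fun v : 'rV[R]_n => v - v 0 i *: delta_mx 0 i) @^-1`
    ball (0 : 'rV[R]_n) 4^-1).

Lemma axis_homB i : {morph axis_hom i : s t / s - t}.
Proof. by move=> s t; rewrite /axis_hom scalerBl pB. Qed.

Lemma axis_hom_continuous i : continuous (axis_hom i).
Proof.
move=> t; apply: continuous_comp; last exact: p_cont.
exact: scalel_continuous.
Qed.

Lemma axis_hom_eq0 i t : axis_hom i t = 0 <-> t \is a Num.int.
Proof.
rewrite /axis_hom p_ker; split=> [/mxOverP/(_ 0 i)|tZ].
  by rewrite !mxE !eqxx mulr1.
by apply/mxOverP => k j; rewrite !mxE rpredM // natr_int.
Qed.

Lemma axis_tube_open i : open (axis_tube i).
Proof.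
apply: p_open; apply: open_comp; last exact: ball_open.
move=> v _; apply: (@continuousB _ _ _ id
  (fun u : 'rV[R]_n => u 0 i *: delta_mx 0 i)).
  exact: cvg_id.
apply: (@continuous_comp _ _ _ (fun u : 'rV[R]_n => u 0 i)
  (fun t : R => t *: delta_mx 0 i)); first exact: coord_continuous.
exact: scalel_continuous.
Qed.

Lemma axis_sub_tube i : range (axis_hom i) `<=` axis_tube i.
Proof.
move=> _ [t _ <-]; exists (t *: delta_mx 0 i) => //=.
by rewrite !mxE !eqxx mulr1 subrr; exact: ballxx.
Qed.

Lemma axis_circle_compact i : compact (range (axis_hom i)).
Proof.
have -> : range (axis_hom i) = axis_hom i @` `[0, 1]%classic.
  apply/seteqP; split=> _ [t _ <-]; last by exists t.
  exists (t - (Num.floor t)%:~R).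
    rewrite /= in_itv/=; have /andP[] := floor_itv t.
    by rewrite intrD => ? ?; apply/andP; split; lra.
  by rewrite axis_homB [X in _ - X](iffRL (axis_hom_eq0 i _)) ?subr0 ?intr_int.
apply: continuous_compact; last exact: segment_compact.
exact/continuous_subspaceT/axis_hom_continuous.
Qed.

Lemma axis_circleP i : range (axis_hom i) \in closed_subgroup G.
Proof.
apply/mem_set; split.
- apply: compact_closed; last exact: axis_circle_compact.
  exact: covering_hausdorff.
- by exists 0 => //; exact: morph_sub0 (@axis_homB i).
- by move=> _ _ [s _ <-] [t _ <-]; exists (s - t) => //; exact: axis_homB.
Qed.

(** The lift [t |-> t w] of [f] has [w j = 0] for [j != i], as otherwise the
    [j]-th coordinate takes the value [1/2], which is at distance [1/2] from the
    integers. So [f] is multiplication by some [a] along the [i]-th axis: [a] is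
    an integer since [f 1 = 0], it is nonzero since [f (1/2) != 0], and [1/a] is
    an integer since [f (1/a) = 0]. *)
Lemma hom_into_tube i (f : R -> G) : continuous f ->
  {morph f : s t / s - t} -> (forall t, f t = 0 <-> t \is a Num.int) ->
  range f `<=` axis_tube i ->
  exists2 a, a = 1 \/ a = -1 & forall t, f t = axis_hom i (t * a).
Proof.
move=> fc fB f_ker f_tube; have [w fw] := hom_lift fc fB.
have w0 j : j != i -> w 0 j = 0.
  move=> ji; apply/eqP/negPn/negP => wj0.
  have [v v4 vE] := f_tube _ (imageT f (2^-1 / w 0 j)).
  have : v - (2^-1 / w 0 j) *: w \is a mxOver Num.int.
    by apply/p_ker; rewrite pB vE fw subrr.
  move=> /mxOverP/(_ 0 j); rewrite !mxE divfK // => vZ.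
  have {v4} : `|v 0 j| < 4^-1.
    move: v4; rewrite /= -ball_normE /= sub0r normrN; apply: le_lt_trans.
    apply: le_trans (normr_coord_le _ j).
    by rewrite !mxE (negbTE ji) andbF mulr0 subr0.
  rewrite ltr_norml => /andP[vl vr].
  have := small_int_eq0 vZ; rewrite ltr_norml => /(_ ltac:(lra)); lra.
pose a := w 0 i; have wE : w = a *: delta_mx 0 i.
  apply/rowP => j; rewrite !mxE eqxx /=; have [->|ji] := eqVneq j i.
    by rewrite mulr1.
  by rewrite mulr0 w0.
have fE t : f t = axis_hom i (t * a) by rewrite fw wE scalerA.
exists a => //.
have aZ : a \is a Num.int.
  apply/(axis_hom_eq0 i); rewrite -[a]mul1r -fE.
  by apply/f_ker; exact: int_num1.
have a0 : a != 0.
  apply/eqP => a0; have : f 2^-1 = 0.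
    by rewrite fE a0 mulr0; apply/axis_hom_eq0; exact: int_num0.
  by move=> /f_ker/small_int_eq0; rewrite ger0_norm ?invr_ge0//; lra.
have aVZ : a^-1 \is a Num.int.
  by apply/f_ker; rewrite fE mulVf//; apply/axis_hom_eq0; exact: int_num1.
have := norm_intr_ge1 aZ a0; have := norm_intr_ge1 aVZ (invr_neq0 a0).
rewrite normfV => aV1 a1.
have /eqP : `|a| = 1.
  apply: le_anti; rewrite a1 andbT.
  by rewrite -[`|a|]invrK invf_le1 ?invr_gt0 ?normr_gt0.
by rewrite eqr_norml ler01 andbT => /orP[] /eqP ->; [left|right].
Qed.

Definition axis_circle i : Sub G :=
  exist (fun H => H \in closed_subgroup G) (range (axis_hom i))
    (axis_circleP i).

Lemma axis_circle_Subp i : Subp R G (axis_circle i).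
Proof.
move=> C [_ sC]; apply: sC; exists (axis_hom i) => //.
split; first exact: axis_hom_continuous.
exact: (morph_subD (@axis_homB i)).
Qed.

End Covering.

(** * Distality implies finite order *)

Section Iteration.
Variables (R : realType) (G : topologicalZmodType) (T : topGroupIso G G).

Lemma iter_isoB k : {morph iter k T : x y / x - y}.
Proof. by elim: k => // k IHk x y; rewrite !iterS IHk isoB. Qed.

Lemma val_iter_Sub_map k (H : Sub G) :
  \val (iter k (Sub_homeo T) H) = iter k T @` \val H.
Proof.
elim: k => [|k IHk]; first by rewrite image_id.
by rewrite iterS /= IHk image_comp.
Qed.

Lemma val_iter_restrict k (H : Subp R G) :
  \val (iter k (homeo_restrict (@Subp_invariant R G T)) H) =
  iter k (Sub_homeo T) (\val H).
Proof. by elim: k => //= k ->. Qed.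

End Iteration.

Section DistalImpliesFiniteOrder.
Variables (R : realType) (n : nat) (G : topologicalZmodType).
Variables (p : 'rV[R]_n -> G) (T : topGroupIso G G).
Hypothesis p_cov : torus_covering p.

(** Being disjoint from the complement of the tube is an open condition on
    closed subgroups, so by recurrence some positive power of [T] maps the
    circle into its tube, hence acts on it as [1] or [-1]; the square of that
    power fixes the circle pointwise. *)
Lemma distal_axis_periodic (i : 'I_n) : acts_distally_on_Subp R T ->
  exists k, (0 < k)%N /\ forall t, iter k T (axis_hom p i t) = axis_hom p i t.
Proof.
move=> Tdistal.
have cG := covering_compact p_cov; have hG := covering_hausdorff p_cov.
have cX : compact [set: Subp R G].
  apply/set_type_compact/(subclosed_compact _ (@Sub_compact G)) => //.
  by apply: closed_bigI => C [].
have hX : hausdorff_space (Subp R G).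
  exact/set_type_hausdorff/Sub_hausdorff.
pose K := ~` axis_tube p i.
have cK : compact K.
  apply: (subclosed_compact _ cG) => //.
  exact/open_closedC/axis_tube_open.
pose x : Subp R G := SigSub (mem_set (axis_circle_Subp p_cov i)).
have xK : nbhs x (set_val @^-1` chabauty_misses K).
  apply: (@set_val_continuous _ (Subp R G) x); apply: open_nbhs_nbhs; split.
    exact: chabauty_misses_open.
  by apply/seteqP; split=> // y [/axis_sub_tube].
have [k [k0]] := distal_recurrent hX cX Tdistal xK.
rewrite /= /chabauty_misses /= set_valE val_iter_restrict.
rewrite val_iter_Sub_map => kK.
have [a aE Ta] : exists2 a, a = 1 \/ a = -1 &
    forall t, (iter k T \o axis_hom p i) t = axis_hom p i (t * a).
  apply: (hom_into_tube p_cov).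
  - move=> t; apply: continuous_comp; first exact: axis_hom_continuous.
    exact: homeo_iter_continuous.
  - by move=> s t /=; rewrite axis_homB // iter_isoB.
  - move=> t; rewrite -(axis_hom_eq0 p_cov i) /=.
    have T0 : iter k T 0 = 0 := morph_sub0 (@iter_isoB _ T k).
    by split=> [|-> //]; rewrite -[in RHS]T0 => /homeo_iter_inj.
  - move=> _ [t _ <-]; apply: contrapT => Kt.
    have /seteqP[/(_ (iter k T (axis_hom p i t))) + _] := kK; apply; split=> //.
    by exists (axis_hom p i t) => //; exists t.
exists (k + k)%N; split=> [|t]; first by rewrite addn_gt0 k0.
rewrite iterD; have /= -> := Ta t; have /= -> := Ta (t * a).
by rewrite -mulrA; case: aE => ->; rewrite ?mulrNN !mulr1.
Qed.

(** The coordinate circles generate the torus, so the product of their periods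
    is a period of [T]. *)
Lemma distal_finite_order : acts_distally_on_Subp R T ->
  exists m, (0 < m)%N /\ forall x, iter m T x = x.
Proof.
move=> Tdistal.
have [_ _ pB p_surj _] := p_cov.
have /choice[k kP] := fun i => distal_axis_periodic i Tdistal.
pose m := (\prod_i k i)%N.
exists m; split=> [|x]; first by apply: prodn_gt0 => i; have [] := kP i.
have [v <-] := p_surj x; rewrite [v]row_sum_delta.
apply: (big_ind (fun u => iter m T (p u) = p u)).
- by rewrite (morph_sub0 pB) (morph_sub0 (@iter_isoB _ T m)).
- move=> u w uE wE.
  by rewrite (morph_subD pB) (morph_subD (@iter_isoB _ T m)) uE wE.
- move=> i _; rewrite /m (bigD1 i) //= mulnC.
  by rewrite iterM iter_fix //; have [_ ->] := kP i.
Qed.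

End DistalImpliesFiniteOrder.

(** * Finite order implies distality *)

Lemma accessible_prod (X Y : topologicalType) :
  accessible_space X -> accessible_space Y -> accessible_space (X * Y)%type.
Proof.
move=> aX aY [a b] [c d]; rewrite xpair_eqE negb_and => /orP[/aX|/aY].
  move=> [A [oA aA cA]]; exists (fst @^-1` A); split; rewrite ?inE in aA cA *.
  - by apply: open_comp => // z _; exact: cvg_fst.
  - by [].
  - by [].
move=> [A [oA bA dA]]; exists (snd @^-1` A); split; rewrite ?inE in bA dA *.
- by apply: open_comp => // z _; exact: cvg_snd.
- by [].
- by [].
Qed.

Lemma accessible_set_type (X : topologicalType) (A : set X) :
  accessible_space X -> accessible_space A.
Proof.
move=> aX x y xy; have [|U [oU xU yU]] := aX (set_val x) (set_val y).
  by apply: contra xy => /eqP/val_inj ->.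
exists (set_val @^-1` U); split; rewrite ?inE in xU yU *.
- by apply: open_comp => // z _; exact: set_val_continuous.
- by [].
- by [].
Qed.

(** When [phi^m] is the identity, the orbit of a pair is finite, hence closed,
    and none of its members is on the diagonal. *)
Lemma finite_order_distal (X : topologicalType) (phi : homeo X X) (m : nat) :
  accessible_space X -> (0 < m)%N -> (forall x, iter m phi x = x) ->
  distal phi.
Proof.
move=> aX m0 phim x y xy.
have iter_mod k z : iter k phi z = iter (k %% m) phi z.
  by rewrite {1}(divn_eq k m) addnC iterD iterM (iter_fix (k %/ m)).
have invE z : homeo_inv phi z = iter m.-1 phi z.
  by apply: (can_inj (homeoK phi)); rewrite homeoVK -iterS prednK.
have zpowE k : exists2 j, (j < m)%N & homeo_zpow phi k =1 iter j phi.
  suff [l lE] : exists l, homeo_zpow phi k =1 iter l phi.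
    exists (l %% m)%N; first by rewrite ltn_mod.
    by move=> z; rewrite lE iter_mod.
  case: k => k; first by exists k.
  by exists (k.+1 * m.-1)%N => z; rewrite iterM /homeo_zpow; apply: eq_iter.
pose S := [set (iter j phi x, iter j phi y) | j in `I_m].
have cS : closed S.
  have /accessible_finite_set_closed := accessible_prod aX aX; apply.
  exact/finite_image/finite_II.
have orbitS : [set (homeo_zpow phi k x, homeo_zpow phi k y) |
    k in [set: int]] `<=` S.
  move=> _ [k _ <-]; have [j jm kj] := zpowE k.
  by exists j => //; rewrite !kj.
apply/seteqP; split=> // -[a b] [/(closure_min cS orbitS)[j _ [xa yb]]].
move=> [d _ [da db]]; apply: xy.
by apply: (@homeo_iter_inj _ phi j); rewrite xa yb -da.
Qed.

Theorem theorem3p1 (R : realType) (n : nat) (n_gt0 : (0 < n)%N)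
    (G : topologicalZmodType) (G_torus : is_torus R n G)
    (T : topGroupIso G G) :
  acts_distally_on_Subp R T <->
  exists m : nat, (0 < m)%N /\ forall x : G, iter m T x = x.
Proof.
have [p p_cov] := is_torus_covering G_torus.
split=> [|[m [m0 Tm]]]; first exact: distal_finite_order p_cov.
apply: (finite_order_distal _ m0).
  exact/accessible_set_type/Sub_accessible.
move=> H; apply/val_inj/val_inj; rewrite val_iter_restrict val_iter_Sub_map.
by apply: eq_image_id => x _; exact: Tm.
Qed.
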